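(* Every countable model $\langle M,\in^M\rangle$ of set theory is universal for all countable $\mathrm{Ord}^M$-graded binary relations: if $\langle G,\rightharpoonup\rangle$ is a countable $\mathrm{Ord}^M$-graded digraph, then $\langle G,\rightharpoonup\rangle$ is isomorphic to a submodel of $\langle M,\in^M\rangle$.
   Context: A model of set theory is a first-order structure $\langle M,\in^M\rangle$ satisfying at least the Kripke–Platek axioms KP of set theory; it need not be well-founded. $\mathrm{Ord}^M$ is the linear order of the ordinals of $M$ (possibly ill-founded). A digraph $\langle G,\rightharpoonup\rangle$ is a set $G$ with a binary relation $\rightharpoonup$. For a linear order $\ell$, a digraph is $\ell$-graded if each $v\in G$ is assigned a value $\alpha_v\in\ell$ such that $v\rightharpoonup w$ implies $\alpha_v<\alpha_w$. The grading is external, and the isomorphism is of digraphs only. A submodel is an arbitrary subset with the restricted relation (an induced substructure). *)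

(* Defs.v *)
From mathcomp Require Import all_boot.
From mathcomp Require Import classical_sets functions cardinality.

Set Implicit Arguments.
Unset Strict Implicit.
Unset Printing Implicit Defensive.

(* First-order formulas in the language {∈, =}, with de Bruijn indices: the
   quantifiers bind index 0 and shift the other indices by one. *)
Inductive formula : Type :=
| FMem of nat & nat
| FEq of nat & nat
| FNot of formula
| FAnd of formula & formula
| FOr of formula & formula
| FImp of formula & formula
| FAll of formula
| FEx of formula.

(* Bounded quantifiers are the abbreviations  ∀x (x ∈ y → φ)  and
   ∃x (x ∈ y ∧ φ).  The bound y is read outside the quantifier, hence i.+1
   under the binder: it is never the bound variable itself. *)
Inductive delta0 : formula -> Prop :=
| delta0_mem i j : delta0 (FMem i j)
| delta0_eq i j : delta0 (FEq i j)
| delta0_not p : delta0 p -> delta0 (FNot p)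
| delta0_and p q : delta0 p -> delta0 q -> delta0 (FAnd p q)
| delta0_or p q : delta0 p -> delta0 q -> delta0 (FOr p q)
| delta0_imp p q : delta0 p -> delta0 q -> delta0 (FImp p q)
| delta0_ball i p : delta0 p -> delta0 (FAll (FImp (FMem 0 i.+1) p))
| delta0_bex i p : delta0 p -> delta0 (FEx (FAnd (FMem 0 i.+1) p)).

Definition scons (M : Type) (x : M) (e : nat -> M) : nat -> M :=
  fun n => if n is n'.+1 then e n' else x.

Fixpoint sat (M : Type) (mem : M -> M -> Prop) (e : nat -> M) (p : formula) :
    Prop :=
  match p with
  | FMem i j => mem (e i) (e j)
  | FEq i j => e i = e j
  | FNot q => ~ sat mem e q
  | FAnd q r => sat mem e q /\ sat mem e r
  | FOr q r => sat mem e q \/ sat mem e r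
  | FImp q r => sat mem e q -> sat mem e r
  | FAll q => forall x : M, sat mem (scons x e) q
  | FEx q => exists x : M, sat mem (scons x e) q
  end.

(* Kripke-Platek set theory, with the axiom of infinity and the foundation
   scheme for all formulas.  The environment e supplies the parameters of an
   instance of a scheme.  The relation need not be well-founded: foundation is
   only asserted for classes definable in the structure.
   Infinity cannot be dropped: in the hereditarily finite sets every element
   has finitely many members, while a vertex of a graded countable digraph may
   have infinitely many predecessors. *)
Record KP_model (M : Type) (mem : M -> M -> Prop) : Prop := {
  KP_extensionality : forall x y : M,
    (forall z, mem z x <-> mem z y) -> x = y;
  KP_foundation : forall (p : formula) (e : nat -> M),
    (exists x, sat mem (scons x e) p) ->
    exists x, sat mem (scons x e) p /\
              forall y, mem y x -> ~ sat mem (scons y e) p;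
  KP_pairing : forall x y : M,
    exists z, forall u, mem u z <-> u = x \/ u = y;
  KP_union : forall x : M,
    exists z, forall u, mem u z <-> exists y, mem y x /\ mem u y;
  KP_infinity : exists w : M,
    (exists z, mem z w /\ forall u, ~ mem u z) /\
    (forall x, mem x w ->
       exists y, mem y w /\ forall u, mem u y <-> mem u x \/ u = x);
  KP_delta0_separation : forall p : formula, delta0 p ->
    forall (e : nat -> M) (a : M),
      exists b, forall x, mem x b <-> mem x a /\ sat mem (scons x e) p;
  KP_delta0_collection : forall p : formula, delta0 p ->
    forall (e : nat -> M) (a : M),
      (forall x, mem x a -> exists y, sat mem (scons y (scons x e)) p) ->
      exists b, forall x, mem x a ->
        exists y, mem y b /\ sat mem (scons y (scons x e)) p
}.

Definition is_transitive (M : Type) (mem : M -> M -> Prop) (x : M) : Prop :=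
  forall y z, mem y x -> mem z y -> mem z x.

(* The usual definition in the presence of foundation: a transitive set of
   transitive sets, evaluated in the structure. *)
Definition is_ordinal (M : Type) (mem : M -> M -> Prop) (x : M) : Prop :=
  is_transitive mem x /\ forall y, mem y x -> is_transitive mem y.

Definition Ord (M : Type) (mem : M -> M -> Prop) : Type :=
  {x : M | is_ordinal mem x}.

Definition Ord_lt (M : Type) (mem : M -> M -> Prop) (a b : Ord mem) : Prop :=
  mem (proj1_sig a) (proj1_sig b).

Definition is_grading (L G : Type) (lt : L -> L -> Prop)
    (edge : G -> G -> Prop) (alpha : G -> L) : Prop :=
  forall v w : G, edge v w -> lt (alpha v) (alpha w).

(* The submodel is the substructure of M induced on the subset S. *)
Definition isomorphic_to_submodel (G M : Type) (edge : G -> G -> Prop)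
    (mem : M -> M -> Prop) : Prop :=
  exists (S : set M) (f : G -> M),
    set_bij (@setT G) S f /\ forall v w : G, edge v w <-> mem (f v) (f w).

(* Main.v *)
(* A Delta0 relation [rado] makes a set [S] of [M], which contains enough finite
   sets of numerals, behave like the countable random graph, so the vertices v of G
   receive distinct codes s(v) in S with: s(v) and s(w) are rado-adjacent iff
   v -> w or w -> v, for distinct v and w.  Inside M, recursion on the ordinal b
   defines
     T(b, s) = {S, b, s} ∪ {T(c, t) : c ∈ b, t ∈ S, rado t s}.
   The members b and s of T(b, s) can be recovered from it, because it has no
   other ordinal member and no other member in S.  Hence T is injective, and
   v |-> T(alpha v, s(v)) is the required embedding: of the two possible edges
   between v and w only the one that increases the grade can occur. *)
Require Import Defs.
From mathcomp Require Import all_boot.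
From mathcomp Require Import classical_sets functions cardinality.
From mathcomp Require Import boolp.

Set Implicit Arguments.
Unset Strict Implicit.
Unset Printing Implicit Defensive.

(** * Renaming of variables in formulas *)

Definition up (r : nat -> nat) : nat -> nat := scons 0 (fun n => (r n).+1).

Fixpoint ren (r : nat -> nat) (p : formula) : formula :=
  match p with
  | FMem i j => FMem (r i) (r j)
  | FEq i j => FEq (r i) (r j)
  | FNot q => FNot (ren r q)
  | FAnd q s => FAnd (ren r q) (ren r s)
  | FOr q s => FOr (ren r q) (ren r s)
  | FImp q s => FImp (ren r q) (ren r s)
  | FAll q => FAll (ren (up r) q)
  | FEx q => FEx (ren (up r) q)
  end.

Lemma delta0_ren r p : delta0 p -> delta0 (ren r p).
Proof. by move=> d; elim: d r => *; constructor; auto. Qed.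

Lemma sat_ren (M : Type) (mem : M -> M -> Prop) p r (e e' : nat -> M) :
  (forall n, e (r n) = e' n) -> sat mem e (ren r p) <-> sat mem e' p.
Proof.
have up_e q e1 e2 x : (forall n, e1 (q n) = e2 n) ->
  forall n, scons x e1 (up q n) = scons x e2 n by move=> E [|n] /=.
elim: p r e e' => [i j|i j|p IH|p IHp q IHq|p IHp q IHq|p IHp q IHq|p IH|p IH]
  r e e' E /=; rewrite ?E //.
- by rewrite (IH _ _ _ E).
- by rewrite (IHp _ _ _ E) (IHq _ _ _ E).
- by rewrite (IHp _ _ _ E) (IHq _ _ _ E).
- by rewrite (IHp _ _ _ E) (IHq _ _ _ E).
- by split=> H x; move: (H x); rewrite (IH _ _ _ (up_e _ _ _ _ x E)).
- by split=> -[x H]; exists x; move: H; rewrite (IH _ _ _ (up_e _ _ _ _ x E)).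
Qed.

Definition FBall i p := FAll (FImp (FMem 0 i.+1) p).
Definition FBex i p := FEx (FAnd (FMem 0 i.+1) p).

(** * First consequences of the axioms *)

Section KP.
Context (M : Type) (mem : M -> M -> Prop) (M_KP : KP_model mem).
Local Notation "x ∈ y" := (mem x y) (at level 70).

(** Collection gives a bounding set; Delta0 separation then removes from it all that is not a
    witness for some member of [a]. *)
Lemma strong_collection p (e : nat -> M) a : delta0 p ->
  (forall x, x ∈ a -> exists y, sat mem (scons y (scons x e)) p) ->
  exists b, (forall x, x ∈ a ->
               exists y, y ∈ b /\ sat mem (scons y (scons x e)) p) /\
            (forall y, y ∈ b ->
               exists x, x ∈ a /\ sat mem (scons y (scons x e)) p).
Proof.
move=> dp /(KP_delta0_collection M_KP dp)[b0 cov].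
(* [swap] exchanges the first two variables and skips index 2, which holds [a] during separation. *)
pose swap := scons 1 (scons 0 (fun n => n.+3)).
have dq : delta0 (FBex 1 (ren swap p)) by constructor; apply: delta0_ren.
have [b bP] := KP_delta0_separation M_KP dq (scons a e) b0.
have swapP x y : sat mem (scons x (scons y (scons a e))) (ren swap p) <->
                 sat mem (scons y (scons x e)) p.
  by apply: sat_ren => -[|[|n]].
exists b; split=> [x xa|y /bP[_ [x [xa /swapP H]]]]; last by exists x.
have [y [yb0 H]] := cov x xa; exists y; split=> //.
by apply/bP; split=> //; exists x; split=> //; apply/swapP.
Qed.

Lemma ext_eq x y : (forall z, z ∈ x <-> z ∈ y) -> x = y.
Proof. exact: KP_extensionality. Qed.

Lemma mem_irr x : ~ x ∈ x.
Proof.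
move=> xx; have [|y [/= -> /(_ x xx)]] :=
  KP_foundation M_KP (p := FEq 0 1) (e := fun=> x); first by exists x.
by apply.
Qed.

Lemma union2_ex x y : exists z, forall u, u ∈ z <-> u ∈ x \/ u ∈ y.
Proof.
have [p pP] := KP_pairing M_KP x y; have [z zP] := KP_union M_KP p.
exists z => u; rewrite zP; split=> [[v [/pP[->|->]]]|[]]; auto.
  by exists x; rewrite pP; auto.
by exists y; rewrite pP; auto.
Qed.

Lemma adjoin_ex x m : exists y, forall u, u ∈ y <-> u ∈ x \/ u = m.
Proof.
have [p pP] := KP_pairing M_KP m m; have [z zP] := union2_ex x p.
by exists z => u; rewrite zP pP; intuition.
Qed.

(* Each [FName] below is a formula whose arguments are de Bruijn indices; its
   satisfaction unfolds by conversion to the predicate [name]. *)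
Definition adjoin y x m :=
  (forall u, u ∈ y -> u ∈ x \/ u = m) /\ (forall u, u ∈ x -> u ∈ y) /\ m ∈ y.

Definition FAdjoin y x m :=
  FAnd (FBall y (FOr (FMem 0 x.+1) (FEq 0 m.+1)))
       (FAnd (FBall x (FMem 0 y.+1)) (FMem m y)).

Lemma adjoinP y x m : adjoin y x m <-> forall u, u ∈ y <-> u ∈ x \/ u = m.
Proof.
split=> [[H1 [H2 H3]] u|H]; first by split; [exact: H1|case=> [/H2|->]].
by split; [|split] => [u /H|u xu|] //; apply/H; auto.
Qed.

(** * Finite sets of numerals *)

Section FiniteSets.
Context (o : M) (o_empty : forall u, ~ u ∈ o).

Definition zero_or_succ n := n = o \/ exists k, k ∈ n /\ adjoin n k k.
Definition natural n :=
  zero_or_succ n /\ forall m, m ∈ n -> zero_or_succ m.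
(* Not the finite subsets of [n] exactly: [P] need only be closed under
   adjoining elements of [n], which makes its existence provable by induction
   on [n] without any recursive definition. *)
Definition fin_closed P n :=
  o ∈ P /\ forall x, x ∈ P -> forall m, m ∈ n -> exists y, y ∈ P /\ adjoin y x m.

Definition FZeroSucc n o := FOr (FEq n o) (FBex n (FAdjoin n.+1 0 0)).
Definition FNatural n o :=
  FAnd (FZeroSucc n o) (FBall n (FZeroSucc 0 o.+1)).
Definition FFinClosed P n o :=
  FAnd (FMem o P) (FBall P (FBall n.+1 (FBex P.+2 (FAdjoin 0 2 1)))).

(** Foundation gives a minimal counterexample m. If m = k ∪ {k} and P works for k, then P ∪ {x ∪ {k}
    : x ∈ P} works for m. *)
Lemma fin_closed_ex n : natural n -> exists P, fin_closed P n.
Proof.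
move=> nat_n; apply: contrapT => no.
have [|m [/= [nat_m no_m] m_min]] := KP_foundation M_KP
    (p := FAnd (FNatural 0 1) (FNot (FEx (FFinClosed 0 1 2)))) (e := fun=> o).
  by exists n.
have {nat_m} [[m0|[k [km mE]]] pred_m] : natural m by [].
  apply: no_m; rewrite m0.
  have [P PP] := KP_pairing M_KP o o; exists P; split; first by apply/PP; left.
  by move=> x _ ? /o_empty.
apply: no_m; have {}mE := (adjoinP m k k).1 mE.
have nat_k : natural k.
  by split=> [|j jk]; apply: pred_m => //; apply/mE; left.
have {m_min} [P [oP PP]] : exists P, fin_closed P k.
  by apply: contrapT => no_k; apply: (m_min k).
have [||b [b1 b2]] := @strong_collection (FAdjoin 0 1 2) (fun=> k) P.
- by do !constructor.
- by move=> x _; have [y yP] := adjoin_ex x k; exists y; apply/adjoinP.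
have [Q QE] := union2_ex P b; exists Q; split; first by apply/QE; left.
have adj x : x ∈ P -> exists y, y ∈ Q /\ adjoin y x k.
  by move=> /b1[y [yb yx]]; exists y; split=> //; apply/QE; right.
move=> x /QE[xP|xb] j /mE[jk|->]; last 2 first.
(* Since [x] is [x'] with [k] adjoined, first adjoin [j] to [x'] inside [P], then [k]. *)
- have [x' [x'P /adjoinP /= xE]] := b2 x xb.
  have [y [yP /adjoinP yx]] := PP x' x'P j jk.
  have [z [zQ /adjoinP zy]] := adj y yP; exists z; split=> //; apply/adjoinP.
  by move=> u; rewrite zy yx xE; intuition.
- have [x' [x'P /adjoinP /= xE]] := b2 x xb.
  exists x; split; first by apply/QE; right.
  by apply/adjoinP => u; rewrite xE; intuition.
- by have [y [yP yx]] := PP x xP j jk; exists y; split=> //; apply/QE; left.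
- exact: adj.
Qed.

End FiniteSets.

(** One set [F] serves all external predicates [P], because [s] is reached from the empty set in at
    most n steps, each adjoining one standard numeral. *)
Lemma numerals_ex : exists (c : nat -> M) (F : M),
  (forall n z, z ∈ c n <-> exists i, i < n /\ z = c i) /\
  (forall (P : nat -> Prop) n, exists s, s ∈ F /\
     forall z, z ∈ s <-> exists i, i < n /\ P i /\ z = c i).
Proof.
have [w [[o [ow o0]] wS]] := KP_infinity M_KP.
have /choice[f fP] (x : {x | x ∈ w}) : exists y : {y | y ∈ w},
    forall u, u ∈ sval y <-> u ∈ sval x \/ u = sval x.
  by case: x => x xw; have [y [yw yP]] := wS x xw; exists (exist _ y yw).
pose c n := sval (iter n f (exist _ o ow)).
have cw n : c n ∈ w by apply: (proj2_sig (iter n f _)).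
have cS n u : u ∈ c n.+1 <-> u ∈ c n \/ u = c n by apply: fP.
have cP n z : z ∈ c n <-> exists i, i < n /\ z = c i.
  elim: n z => [|n IH] z; first by split=> [/o0|[i []]].
  rewrite cS IH; split=> [[[i [lin ->]]|->]|[i [+ ->]]].
  - by exists i; split=> //; apply: ltnW.
  - by exists n.
  - by rewrite ltnS leq_eqVlt => /predU1P[->|lin]; [right|left; exists i].
have czs n : zero_or_succ o (c n).
  case: n => [|n]; [by left|right; exists (c n)].
  by split; [apply/cS; right|apply/adjoinP/cS].
have cnat n : natural o (c n).
  by split=> [|m /cP[i [_ ->]]]; apply: czs.
(* Members of [w] need not be naturals; the implication makes the relation total on [w]. *)
have [||b [b1 _]] := @strong_collection
    (FImp (FNatural 1 2) (FFinClosed 0 1 2)) (fun=> o) w.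
- by do !constructor.
- move=> x _; have [nat_x|no] := pselect (natural o x).
    by have [P PP] := fin_closed_ex o0 nat_x; exists P.
  by exists o => /no.
have [F FP] := KP_union M_KP b; exists c, F; split=> // P n.
have [Q [Qb /(_ (cnat n))[oQ QP]]] := b1 _ (cw n).
suff /(_ n (leqnn n)) [s [sQ sP]] : forall k, k <= n -> exists s, s ∈ Q /\
    forall z, z ∈ s <-> exists i, i < k /\ P i /\ z = c i.
  by exists s; split=> //; apply/FP; exists Q.
elim=> [|k IH] lekn; first by exists o; split=> // z; split=> [/o0|[i []]].
have [s [sQ sP]] := IH (ltnW lekn).
have [Pk|nPk] := pselect (P k); last first.
  exists s; split=> // z; rewrite sP; split=> -[i [lik [Pi ->]]]; exists i.
    by split=> //; apply: ltnW.
  by split=> //; move: lik Pi; rewrite ltnS leq_eqVlt => /predU1P[->|].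
have [|t [tQ /adjoinP tP]] := QP s sQ (c k); first by apply/cP; exists k.
exists t; split=> // z; rewrite (tP z) sP; split=> [[[i [lik [Pi ->]]]|->]|].
- by exists i; split=> //; apply: ltnW.
- by exists k.
- move=> [i [+ [Pi ->]]]; rewrite ltnS leq_eqVlt => /predU1P[->|lik].
    by right.
  by left; exists i.
Qed.

(** * Ordinals and the adjacency relation on codes *)

Definition transitive x := forall y, y ∈ x -> forall z, z ∈ y -> z ∈ x.
Definition ord x := transitive x /\ forall y, y ∈ x -> transitive y.

Definition FTransitive x := FBall x (FBall 0 (FMem 0 x.+2)).
Definition FOrd x := FAnd (FTransitive x) (FBall x (FTransitive 0)).

Lemma ordP x : is_ordinal mem x <-> ord x.
Proof.
have trP y : is_transitive mem y <-> transitive y.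
  by split=> H u; [move=> uy v; apply: H|move=> v uy; apply: H].
by rewrite /is_ordinal /ord trP; split=> -[H1 H2]; split=> // y /H2 /trP.
Qed.

Lemma ord_mem x y : ord x -> y ∈ x -> ord y.
Proof.
move=> [tx ty] yx; split=> [|z zy]; first exact: ty.
by apply: ty; apply: tx zy.
Qed.

(* On finite sets of numerals this is the countable random graph: the maximum
   of each vertex serves as its identifier. *)
Definition rado t s :=
  (exists m, m ∈ t /\ (forall k, k ∈ t -> k ∈ m \/ k = m) /\ m ∈ s) \/
  (exists m, m ∈ s /\ (forall k, k ∈ s -> k ∈ m \/ k = m) /\ m ∈ t).

Definition FMaxIn t s :=
  FBex t (FAnd (FBall t.+1 (FOr (FMem 0 1) (FEq 0 1))) (FMem 0 s.+1)).
Definition FRado t s := FOr (FMaxIn t s) (FMaxIn s t).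

(** * The recursion for T, by approximations *)

Section Collapse.
Context (S : M) (S_nonempty : exists s, s ∈ S)
  (S_nonord : forall s, s ∈ S -> ~ ord s).

(** For z = T(c, t), the pair c, t is read off the members of z, so no function symbol for T is
    needed. *)
Definition link z b s :=
  exists c, c ∈ z /\ exists t, t ∈ z /\ c ∈ b /\ t ∈ S /\ rado t s.
(* If [U] consists of values of T and includes T(c, t) for all c in b and t in
   S, then [node U x b s] says that x = T(b, s). *)
Definition node U x b s :=
  (forall z, z ∈ x -> z = S \/ z = b \/ z = s \/ z ∈ U /\ link z b s) /\
  S ∈ x /\ b ∈ x /\ s ∈ x /\ forall z, z ∈ U -> link z b s -> z ∈ x.
Definition covers U b :=
  forall c, c ∈ b -> forall t, t ∈ S -> exists y, y ∈ U /\ c ∈ y /\ t ∈ y.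
(** The approximations: sets of values of T that contain every value used in computing their
    members. *)
Definition good U :=
  forall x, x ∈ U -> exists b, b ∈ x /\ exists s, s ∈ x /\
    ord b /\ s ∈ S /\ node U x b s /\ covers U b.

Definition FLink S z b s :=
  FBex z (FBex z.+1 (FAnd (FMem 1 b.+2) (FAnd (FMem 0 S.+2) (FRado 0 s.+2)))).
Definition FNode S U x b s :=
  FAnd (FBall x (FOr (FEq 0 S.+1) (FOr (FEq 0 b.+1) (FOr (FEq 0 s.+1)
         (FAnd (FMem 0 U.+1) (FLink S.+1 0 b.+1 s.+1))))))
  (FAnd (FMem S x) (FAnd (FMem b x) (FAnd (FMem s x)
    (FBall U (FImp (FLink S.+1 0 b.+1 s.+1) (FMem 0 x.+1)))))).
Definition FCovers S U b :=
  FBall b (FBall S.+1 (FBex U.+2 (FAnd (FMem 2 0) (FMem 1 0)))).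
Definition FGood S U :=
  FBall U (FBex 0 (FBex 1 (FAnd (FOrd 1) (FAnd (FMem 0 S.+3)
    (FAnd (FNode S.+3 U.+3 2 1 0) (FCovers S.+3 U.+3 1)))))).

(** For [x] in a good set this amounts to x = T(b, s). *)
Definition tagged x b s := b ∈ x /\ s ∈ x /\ ord b /\ s ∈ S.

(* [S], a member of every T(b, s), keeps T(b, s) from being an ordinal or a
   member of [S]. *)
Lemma S_not_ord : ~ ord S.
Proof. by have [s sS] := S_nonempty => /ord_mem /(_ sS); apply: S_nonord. Qed.

Lemma mem_asym x y : x ∈ y -> ~ y ∈ x.
Proof.
move=> xy yx; have [|z [/= [->|->]]] := KP_foundation M_KP
  (p := FOr (FEq 0 1) (FEq 0 2)) (e := scons x (fun=> y)).
- by exists x; left.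
- by move=> /(_ y yx); apply; right.
- by move=> /(_ x xy); apply; left.
Qed.

Lemma node_ext U x y b s : node U x b s -> node U y b s -> x = y.
Proof.
move=> [x1 [Sx [bx [sx x2]]]] [y1 [Sy [bY [sy y2]]]].
by apply: ext_eq => z; split=> [/x1|/y1] [->|[->|[->|[]]]]; auto.
Qed.

Lemma node_tags U x b s c t : good U -> ord b -> s ∈ S -> node U x b s ->
  tagged x c t -> c = b /\ t = s.
Proof.
move=> gU ob sS [xE _] [cx [tx [oc tS]]].
have US z : z ∈ U -> S ∈ z.
  by move=> /gU[? [_ [? [_ [_ [_ [[_ [? _]] _]]]]]]].
have nSo z : S ∈ z -> ~ ord z by move=> Sz /ord_mem /(_ Sz); exact: S_not_ord.
split.
  case: (xE c cx) => [cE|[//|[cE|[/US/nSo]]]] //.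
  - by case: S_not_ord; rewrite -cE.
  - by case: (S_nonord sS); rewrite -cE.
case: (xE t tx) => [tE|[tE|[//|[/US/mem_asym]]]] //.
- by case: (@mem_irr S); rewrite -{1}tE.
- by case: (S_nonord tS); rewrite tE.
Qed.

Lemma goodP U x : good U -> x ∈ U -> exists b s, [/\ tagged x b s, node U x b s
  & covers U b].
Proof.
move=> gU /gU[b [bx [s [sx [ob [sS [nx cb]]]]]]]; exists b, s; split=> //.
Qed.

Lemma good_node U x b s : good U -> x ∈ U -> tagged x b s ->
  node U x b s /\ covers U b.
Proof.
move=> gU xU tx; have [c [t [[_ [_ [oc tS]]] nx cc]]] := goodP gU xU.
by have [-> ->] := node_tags gU oc tS nx tx.
Qed.

Lemma good_unique U V x y b s : good U -> good V -> x ∈ U -> y ∈ V ->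
  tagged x b s -> tagged y b s -> x = y.
Proof.
move=> gU gV xU yV tx ty; apply: contrapT => xy.
(* The second tag changes along the recursion, so the minimal [b] is taken over all [x], [y] and [s]
   at once. *)
pose p := FEx (FEx (FEx (FAnd (FMem 2 4) (FAnd (FMem 1 5)
  (FAnd (FAnd (FMem 3 2) (FAnd (FMem 0 2) (FAnd (FOrd 3) (FMem 0 6))))
  (FAnd (FAnd (FMem 3 1) (FAnd (FMem 0 1) (FAnd (FOrd 3) (FMem 0 6))))
  (FNot (FEq 2 1)))))))).
have [|b' [/= [x' [y' [s' [x'U [y'V [tx' [ty' xy']]]]]]] b_min]] :=
  KP_foundation M_KP (p := p) (e := scons U (scons V (fun=> S))).
  by exists b, x, y, s.
have {b_min} IH c t u v : c ∈ b' -> u ∈ U -> v ∈ V -> tagged u c t ->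
    tagged v c t -> u = v.
  move=> cb uU vV tu tv; apply: contrapT => uv; apply: (b_min c cb).
  by exists u, v, t.
have [[x1 [Sx [bx [sx x2]]]] bU] := good_node gU x'U tx'.
have [[y1 [Sy [bY [sy y2]]]] bV] := good_node gV y'V ty'.
have ob : ord b' by case: tx' => _ [_ []].
apply: xy'; apply: ext_eq => z; split=> [/x1|/y1] [->|[->|[->|[zU zl]]]] //.
- have [c [cz [t [tz [cb [tS _]]]]]] := zl.
  have [v [vV [cv tv]]] := bV c cb t tS; have oc := ord_mem ob cb.
  by rewrite (IH c t z v) //; apply: y2 => //; rewrite -(IH c t z v).
- have [c [cz [t [tz [cb [tS _]]]]]] := zl.
  have [v [vU [cv tv]]] := bU c cb t tS; have oc := ord_mem ob cb.
  by rewrite -(IH c t v z) //; apply: x2 => //; rewrite (IH c t v z).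
Qed.

(** A linked member of another set in [B] already lies in [U] by [good_unique], so passing from [U]
    to the union adds nothing to a node. *)
Lemma good_union B V : (forall U, U ∈ B -> good U) ->
  (forall x, x ∈ V <-> exists U, U ∈ B /\ x ∈ U) -> good V.
Proof.
move=> gB VE x /VE[U [UB xU]]; have gU := gB _ UB.
have [b [s [[bx [sx [ob sS]]] nx cb]]] := goodP gU xU.
exists b; split=> //; exists s; split=> //; split=> //; split=> //; split.
  have [x1 [Sx [_ [_ x2]]]] := nx.
  split=> [z /x1 [->|[->|[->|[zU zl]]]]|]; auto.
    by right; right; right; split=> //; apply/VE; exists U.
  do 3!split=> //; move=> z /VE[W [WB zW]] zl.
  have [c [cz [t [tz [cb' [tS _]]]]]] := zl.
  have [v [vU [cv tv]]] := cb c cb' t tS; have oc := ord_mem ob cb'.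
  by apply: x2 => //; rewrite (good_unique (gB W WB) gU zW vU (b := c) (s := t)).
move=> c cb' t tS; have [v [vU tv]] := cb c cb' t tS; exists v; split=> //.
by apply/VE; exists U.
Qed.

(** At a minimal counterexample [b], approximations for all c ∈ b are united into [V], and the set
    [C] of all T(b, s) is added. *)
Lemma good_ex b : ord b -> exists U, good U /\
  forall s, s ∈ S -> exists x, x ∈ U /\ b ∈ x /\ s ∈ x.
Proof.
move=> ob; apply: contrapT => no.
pose F := FAnd (FGood 2 0) (FBall 2 (FBex 1 (FAnd (FMem 3 0) (FMem 1 0)))).
have dF : delta0 F by do !constructor.
have [|{no ob}b [/= [ob no] b_min]] := KP_foundation M_KP
    (p := FAnd (FOrd 0) (FNot (FEx F))) (e := fun=> S).
  by exists b; split; [exact: ob|exact: no].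
apply: no.
have [||B [B1 B2]] := @strong_collection F (fun=> S) b => //.
  move=> c cb; apply: contrapT => no; apply: (b_min c cb).
  by split=> //; apply: ord_mem cb.
have [V VE] := KP_union M_KP B.
have gB U : U ∈ B -> good U by move=> /B2[c [_ []]].
have gV : good V.
  by apply: good_union gB _ => x; rewrite VE; split=> -[U []]; exists U.
have cV : covers V b.
  move=> c cb t tS; have [U [UB [_ /(_ t tS)[x [xU xct]]]]] := B1 c cb.
  by exists x; split=> //; apply/VE; exists U.
have node_ex s : exists x, node V x b s.
  have [v vE] := KP_delta0_separation M_KP (p := FLink 3 0 1 2)
    ltac:(do !constructor) (scons b (scons s (fun=> S))) V.
  have [v1 v1E] := adjoin_ex v s; have [v2 v2E] := adjoin_ex v1 b.
  have [x xE] := adjoin_ex v2 S; exists x.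
  have {}xE z : z ∈ x <-> z = S \/ z = b \/ z = s \/ z ∈ V /\ link z b s.
    rewrite xE v2E v1E vE; tauto.
  by split=> [z /xE|]; rewrite ?xE; intuition; apply/xE; auto.
have [||C [C1 C2]] := @strong_collection (FNode 4 2 0 3 1)
    (scons V (scons b (fun=> S))) S.
- by do !constructor.
- by move=> s _; exact: node_ex.
have {}C2 z : z ∈ C -> exists s, s ∈ S /\ node V z b s := C2 z.
have [U UE] := union2_ex V C; exists U; split; last first.
  move=> s /C1[x [xC [_ [_ [bx [sx _]]]]]].
  by exists x; split=> //; apply/UE; right.
(* A member of [C] has first tag [b], so it can be linked only to nodes above [b]. *)
have link_old z b' s' : z ∈ C -> link z b' s' -> ord b' -> b ∈ b'.
  move=> /C2[s [sS nz]] [c [cz [t [tz [cb' [tS _]]]]]] ob'.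
  by have [<- _] := node_tags gV ob sS nz
    (conj cz (conj tz (conj (ord_mem ob' cb') tS))).
move=> x /UE[xV|xC].
  have [b' [s' [[bx [sx [ob' sS']]] nx cb']]] := goodP gV xV.
  exists b'; split=> //; exists s'; do 3!split=> //.
  split; last first.
    by move=> c /cb' H t /H[y [yV ?]]; exists y; split=> //; apply/UE; left.
  have [x1 [Sx [_ [_ x2]]]] := nx.
  split=> [z /x1 [->|[->|[->|[zV zl]]]]|]; auto.
    by right; right; right; split=> //; apply/UE; left.
  do 3!split=> //; move=> z /UE[zV|zC] zl; apply: x2 => //.
  (* The old node lies above [b], so [V] already contains a value with the tags of [z], and it
     equals [z]. *)
  have [s [sS nz]] := C2 z zC.
  have [y [yV [by' sy]]] := cb' b (link_old z b' s' zC zl ob') s sS.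
  have [ny _] := good_node gV yV (conj by' (conj sy (conj ob sS))).
  by rewrite (node_ext nz ny).
have [s [sS nx]] := C2 x xC; have [x1 [Sx [bx [sx x2]]]] := nx.
exists b; split=> //; exists s; do 3!split=> //.
split; last first.
  by move=> c /cV H t /H[y [yV ?]]; exists y; split=> //; apply/UE; left.
split=> [z /x1 [->|[->|[->|[zV zl]]]]|]; auto.
  by right; right; right; split=> //; apply/UE; left.
do 3!split=> //; move=> z /UE[zV|zC] zl; apply: x2 => //.
by case: (@mem_irr b); apply: link_old zC zl ob.
Qed.

End Collapse.

(** * Codes for the vertices of a countable graph *)

Lemma rado_universal (G : Type) (adj : G -> G -> Prop) :
  countable (@setT G) -> (forall v w, adj v w -> adj w v) ->
  exists (S : M) (s : G -> M), [/\ forall x, x ∈ S -> ~ ord x,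
    forall v, s v ∈ S, injective s &
    forall v w, v <> w -> rado (s v) (s w) <-> adj v w].
Proof.
move=> /countable_injP[g gI] adjC.
have {}gI u v : g u = g v -> u = v by apply: gI; rewrite inE.
have [c [F [cP FP]]] := numerals_ex.
have c_lt i j : i < j -> c i ∈ c j by move=> lij; apply/cP; exists i.
have cI i j : c i = c j -> i = j.
  by case: (ltngtP i j) => // /c_lt + E; rewrite E => /mem_irr.
have lt_c i j : c i ∈ c j -> i < j by move=> /cP[k [lkj /cI ->]].
have [S SE] := KP_delta0_separation M_KP (p := FNot (FOrd 0))
  ltac:(do !constructor) (fun=> F) F.
(* The code of v has maximum c (g v + 1). The shift by one keeps [c 0] out of it, so it is not
   transitive and hence no ordinal. *)
pose P v i := exists u, i = (g u).+1 /\ (u = v \/ adj u v).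
have /choice[s sP] v := FP (P v) (g v).+2.
have sF v := (sP v).1; have {}sP v z : z ∈ s v <->
    exists u, g u <= g v /\ (u = v \/ adj u v) /\ z = c (g u).+1.
  rewrite (sP v).2; split=> [[i [lt_i [[u [iE uv]] ->]]]|[u [le_uv [uv ->]]]].
    by exists u; rewrite iE in lt_i *.
  by exists (g u).+1; split=> //; split=> //; exists u.
have top v : c (g v).+1 ∈ s v by apply/sP; exists v; split=> //; auto.
have max_s v m : m ∈ s v -> (forall k, k ∈ s v -> k ∈ m \/ k = m) ->
    m = c (g v).+1.
  move=> /sP[u [le_uv [_ ->]]] /(_ _ (top v))[/lt_c|->] //.
  by rewrite ltnS ltnNge le_uv.
have is_max v k : k ∈ s v -> k ∈ c (g v).+1 \/ k = c (g v).+1.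
  move=> /sP[u [+ [_ ->]]]; rewrite leq_eqVlt => /predU1P[->|lt_uv].
    by right.
  by left; apply: c_lt.
have sS v : s v ∈ S.
  apply/SE; split; first exact: sF.
  by move=> [/(_ _ (top v) _ (c_lt 0 (g v).+1 isT)) /sP[u [_ [_ /cI]]]].
exists S, s; split=> //.
- by move=> x /SE[_].
- move=> v w E; apply: gI; apply: succn_inj; apply: cI.
  by apply: max_s => [|k]; rewrite -E; [exact: top|exact: is_max].
have maxE v w : v <> w ->
    (exists m, m ∈ s v /\ (forall k, k ∈ s v -> k ∈ m \/ k = m) /\ m ∈ s w) <->
    g v <= g w /\ adj v w.
  move=> vw; split=> [[m [mv [/(max_s _ _ mv) ->]]]|[le_vw a]].
    by move=> /sP[u [le_uw [+ /cI[/gI uv]]]]; rewrite -uv in le_uw * => -[].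
  exists (c (g v).+1); split=> //; split; first exact: is_max.
  by apply/sP; exists v; auto.
move=> v w vw; rewrite /rado !maxE //; last by move=> /esym.
split=> [[[]|[_ /adjC]]|a] //.
by case: (leqP (g v) (g w)) => [|/ltnW]; [left|right; auto].
Qed.

End KP.

(** * The embedding v ↦ T(alpha v, s(v)) *)

Theorem corollary27 (M : Type) (mem : M -> M -> Prop)
    (M_KP : KP_model mem) (M_countable : countable (@setT M))
    (G : Type) (edge : G -> G -> Prop) (G_countable : countable (@setT G))
    (alpha : G -> Ord mem)
    (alpha_grading : is_grading (@Ord_lt M mem) edge alpha) :
  isomorphic_to_submodel edge mem.
Proof.
suff [f [fI fE]] : exists f : G -> M, injective f /\
    forall v w, edge v w <-> mem (f v) (f w).
  exists (range f), f; split=> //; split=> //.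
  by move=> v w _ _; apply: fI.
(* A vertex makes [S] nonempty; on an empty [G] any map will do. *)
have [[v0]|no] := pselect (inhabited G); last first.
  exists (fun v => sval (alpha v)).
  by split=> [v|v]; case: no.
pose a v := sval (alpha v).
have a_lt v w : edge v w -> mem (a v) (a w) by apply: alpha_grading.
have ao v : ord mem (a v) by apply/ordP; exact: (proj2_sig (alpha v)).
have [S [s [S_nonord sS sI sE]]] := rado_universal M_KP
  (adj := fun v w => edge v w \/ edge w v) G_countable
  ltac:(by move=> v w []; auto).
have S0 : exists s, mem s S by exists (s v0).
have /choice[f fP] v : exists x, exists U,
    good mem S U /\ mem x U /\ tagged mem S x (a v) (s v).
  have [U [gU /(_ _ (sS v))[x [xU [ax sx]]]]] := good_ex M_KP S0 S_nonord (ao v).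
  by exists x, U.
have ft v : tagged mem S (f v) (a v) (s v) by have [U [_ []]] := fP v.
have tags v c t : tagged mem S (f v) c t -> c = a v /\ t = s v.
  have [U [gU [fU tv]]] := fP v.
  have [nf _] := good_node M_KP S0 S_nonord gU fU tv.
  exact: (node_tags M_KP S0 S_nonord gU (ao v) (sS v) nf).
exists f; split=> [v w E|v w].
  by apply: sI; apply: (tags w _ _ _).2; rewrite -E; exact: ft.
have [U [gU [fU tw]]] := fP w.
have [[w1 [_ [_ [_ w2]]]] cov] := good_node M_KP S0 S_nonord gU fU tw.
have [av [sv [_ _]]] := ft v.
have Sf : mem S (f v).
  have [V [gV [fV tv]]] := fP v.
  by have [[_ []]] := good_node M_KP S0 S_nonord gV fV tv.
have neq : mem (a v) (a w) -> v <> w by move=> + E; rewrite E => /(mem_irr M_KP).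
split=> [vw|/w1].
  have [y [yU [ay sy]]] := cov _ (a_lt _ _ vw) _ (sS v).
  have [V [gV [fV tv]]] := fP v.
  have <- : y = f v.
    exact: (good_unique M_KP S0 S_nonord gU gV yU fV _ tv).
  apply: w2 => //; exists (a v); split=> //; exists (s v); split=> //.
  split; first exact: a_lt.
  by split=> //; apply/sE; [apply/neq/a_lt|left].
(* As S ∈ f v, the first three cases make [S] a member of itself, an ordinal, or a member of a
   member of itself. *)
case=> [E|[E|[E|[fvU [c [cf [t [tf [ca [tS r]]]]]]]]]].
- by rewrite E in Sf; case: (mem_irr M_KP Sf).
- by rewrite E in Sf; case: (S_not_ord S0 S_nonord (ord_mem (ao w) Sf)).
- by rewrite E in Sf; case: (mem_asym M_KP Sf (sS w)).
have [cE tE] := tags v c t (conj cf (conj tf (conj (ord_mem (ao w) ca) tS))).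
rewrite cE in ca; rewrite tE in r.
(* An edge from w to v would put [a w] in [a v], against [a v] in [a w]. *)
by have [//|/a_lt/(mem_asym M_KP)] := (sE v w (neq ca)).1 r.
Qed.
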